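(* Let $\Pi_{\mathcal A}=\{1324,1342,2413,2431,3124,3142,4213,4231\}$ and $\Pi_{\mathcal S}=\{1243,1423,2143,4123,2413,4213,2431,4231\}$. For all $n\ge 0$, there is an explicit bijection $$\psi:\mathfrak{S}_n(\Pi_{\mathcal A})\to\mathfrak{S}_n(\Pi_{\mathcal S}).$$
   Context: $\mathfrak{S}_n$ is the set of permutations of $[n]=\{1,\dots,n\}$ in one-line notation. A permutation $\sigma$ contains $\pi$ as a pattern if some (not necessarily consecutive) subsequence of $\sigma$ is order-isomorphic to $\pi$; otherwise it avoids $\pi$. $\mathfrak{S}_n(\Pi)$ is the set of $\sigma\in\mathfrak{S}_n$ avoiding every $\pi\in\Pi$. The set $\mathfrak{S}_n(\Pi_{\mathcal A})$ is the set of arc permutations, i.e. those $\sigma\in\mathfrak{S}_n$ such that each prefix $\sigma_1\sigma_2\dots\sigma_i$ is an interval in the integers modulo $n$. The set $\Pi_{\mathcal S}$ is the shuffle of $\{1\}$ with $\{132,312\}$, i.e. all permutations of $\{1,2,3,4\}$ in which the elements $2,3,4$ appear in the order $243$ or $423$. *)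

(* Defs.v *)
From mathcomp Require Import all_boot all_fingroup.

Set Implicit Arguments.
Unset Strict Implicit.
Unset Printing Implicit Defensive.

(* 'S_n permutes {0, ..., n-1}, so values are shifted by one to read
   permutations of {1, ..., n} in the usual way. *)
Definition one_line (n : nat) (s : 'S_n) : seq nat :=
  [seq (s i).+1 | i <- enum 'I_n].

(* The entries of [s] at the positions f 0 < f 1 < ... < f (k-1) are in the
   same relative order as the entries of [p]. *)
Definition occurrence (n k : nat) (s : 'S_n) (p : 'S_k)
    (f : {ffun 'I_k -> 'I_n}) : bool :=
  [forall i : 'I_k, forall j : 'I_k,
     ((i < j) ==> (f i < f j)) && ((s (f i) < s (f j)) == (p i < p j))].

Definition contains (n k : nat) (s : 'S_n) (p : 'S_k) : bool :=
  [exists f : {ffun 'I_k -> 'I_n}, occurrence s p f].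

Definition avoiders (n k : nat) (P : {set 'S_k}) : {set 'S_n} :=
  [set s : 'S_n | [forall p in P, ~~ contains s p]].
Arguments avoiders n {k} P.

Definition Pi_A : {set 'S_4} :=
  [set p : 'S_4 | one_line p \in
     [:: [:: 1; 3; 2; 4]; [:: 1; 3; 4; 2]; [:: 2; 4; 1; 3]; [:: 2; 4; 3; 1];
         [:: 3; 1; 2; 4]; [:: 3; 1; 4; 2]; [:: 4; 2; 1; 3]; [:: 4; 2; 3; 1]]].

Definition Pi_S : {set 'S_4} :=
  [set p : 'S_4 | one_line p \in
     [:: [:: 1; 2; 4; 3]; [:: 1; 4; 2; 3]; [:: 2; 1; 4; 3]; [:: 4; 1; 2; 3];
         [:: 2; 4; 1; 3]; [:: 4; 2; 1; 3]; [:: 2; 4; 3; 1]; [:: 4; 2; 3; 1]]].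

(* Main.v *)
Require Import Defs.
From mathcomp Require Import all_boot all_fingroup.
From mathcomp Require Import zify.

(* A permutation s avoids Pi_A when, on the circle of values, the chord through
   two entries never separates two earlier entries; it is enough to take s_0 as
   one of the earlier two.  It avoids Pi_S when, once the least value is deleted,
   no entry lies between two earlier ones.  Rotate the values of s so that s_0
   becomes 0: the first condition then says that no entry other than s_0 lies
   between two later ones.  So reverse the word of nonzero entries, and reinsert
   the 0 at position s_0 in order to remember the rotation. *)

(** * Pattern avoidance in terms of relative order *)

Lemma ex_standardization k (v : 'I_k -> nat) : injective v ->
  exists p : 'S_k, forall i j, (p i < p j) = (v i < v j).
Proof.
(* The rank of [i] is the number of indices with a smaller value. *)
move=> v_inj; pose below i := [set j | v j < v i].
have below_lt i : #|below i| < k.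
  rewrite -[X in _ < X](card_ord k) -cardsT; apply: proper_card.
  apply/properP; split; first exact: subsetT.
  by exists i; rewrite ?inE ?ltnn.
have below_mono i j : v i < v j -> #|below i| < #|below j|.
  move=> lt_ij; apply: proper_card; apply/properP; split.
    by apply/subsetP => l; rewrite !inE => /ltn_trans; apply.
  by exists i; rewrite !inE ?ltnn.
have below_ltE i j : (#|below i| < #|below j|) = (v i < v j).
  case: (ltngtP (v i) (v j)) => [/below_mono // | /below_mono lt_ji | /v_inj ->].
    by apply/negbTE; rewrite -leqNgt ltnW.
  exact: ltnn.
have rank_inj : injective (fun i => Ordinal (below_lt i)).
  move=> i j [eq_ij]; apply: v_inj.
  by case: (ltngtP (v i) (v j)) => //; rewrite -below_ltE eq_ij ltnn.
by exists (perm rank_inj) => i j; rewrite !permE below_ltE.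
Qed.

(** Chosen entries can only form the pattern that is their standardization, so avoiding a whole set
    becomes one test [Q] on their relative order. *)
Lemma avoiders_relP n k (P : {set 'S_k}) (Q : rel 'I_k -> bool) (s : 'S_n) :
    (forall r r' : rel 'I_k, r =2 r' -> Q r = Q r') ->
    (forall p : 'S_k, (p \in P) = Q (fun i j => p i < p j)) ->
  s \in avoiders n P <->
  forall f : 'I_k -> 'I_n, {homo f : i j / i < j} ->
    ~~ Q (fun i j => s (f i) < s (f j)).
Proof.
move=> Q_ext PQ; rewrite inE; split=> [/forall_inP avoid f f_homo | avoid].
  have f_inj : injective (fun i => nat_of_ord (s (f i))).
    move=> i j /val_inj/perm_inj eq_f; apply: val_inj.
    by case: (ltngtP i j) => // /f_homo; rewrite eq_f ltnn.
  have [p pE] := ex_standardization _ _ f_inj.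
  apply/negP => Qf; have /avoid/negP[] : p \in P by rewrite PQ (Q_ext _ _ pE).
  apply/existsP; exists (finfun f); apply/forallP => i; apply/forallP => j.
  by rewrite !ffunE pE eqxx andbT; apply/implyP/f_homo.
apply/forall_inP => p pP; apply/negP => /existsP[f /forallP occ].
have f_homo : {homo f : i j / i < j}.
  by move=> i j; have /forallP/(_ j)/andP[/implyP] := occ i.
have /negP[] := avoid f f_homo; rewrite (Q_ext _ (fun i j => p i < p j)) -?PQ //.
by move=> i j; have /forallP/(_ j)/andP[_ /eqP] := occ i.
Qed.

(** * The two pattern sets as conditions on triples *)

Definition between {T} (r : rel T) (x y z : T) : bool :=
  (r y x && r x z) || (r z x && r x y).

(* The chord [c d] of a circle separates [a] from [b]. *)
Definition crossing {T} (r : rel T) (a b c d : T) : bool :=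
  between r a c d (+) between r b c d.

(* The least entry is the 1, wherever it stands, and the others read 243 or 423. *)
Definition rooted {T} (r : rel T) (a b c d : T) : bool :=
  [|| [&& r a b, r a c, r a d & between r d b c],
      [&& r b a, r b c, r b d & between r d a c],
      [&& r c a, r c b, r c d & between r d a b] |
      [&& r d a, r d b, r d c & between r c a b]].

Definition i0 : 'I_4 := @Ordinal 4 0 isT.
Definition i1 : 'I_4 := @Ordinal 4 1 isT.
Definition i2 : 'I_4 := @Ordinal 4 2 isT.
Definition i3 : 'I_4 := @Ordinal 4 3 isT.

Lemma one_line4 (p : 'S_4) :
  one_line p = [:: (p i0).+1; (p i1).+1; (p i2).+1; (p i3).+1].
Proof.
rewrite /one_line; have -> : enum 'I_4 = [:: i0; i1; i2; i3].
  by apply: (inj_map val_inj); rewrite val_enum_ord.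
by [].
Qed.

(** Elements of ['S_4] do not evaluate well; quadruples of naturals do, so the premise is settled by
    computation. *)
Lemma perm4_ind (B : nat -> nat -> nat -> nat -> bool) :
    (let I := iota 0 4 in
     all (fun a => all (fun b => all (fun c => all (fun d =>
       uniq [:: a; b; c; d] ==> B a b c d) I) I) I) I) ->
  forall p : 'S_4, B (p i0) (p i1) (p i2) (p i3).
Proof.
move=> allB p; have mem4 (i : 'I_4) : (p i : nat) \in iota 0 4.
  by rewrite mem_iota ltn_ord.
move: allB => /allP/(_ _ (mem4 i0))/allP/(_ _ (mem4 i1)).
move=> /allP/(_ _ (mem4 i2))/allP/(_ _ (mem4 i3))/implyP; apply.
have p_inj : injective (fun i => p i : nat) by move=> i j /val_inj/perm_inj.
by rewrite (map_inj_uniq p_inj [:: i0; i1; i2; i3]).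
Qed.

Lemma mem_Pi_A (p : 'S_4) :
  (p \in Pi_A) = crossing (fun i j : 'I_4 => p i < p j) i0 i1 i2 i3.
Proof.
rewrite inE one_line4; set L := (X in _ \in X); apply/eqP.
pose B a b c d := ([:: a.+1; b.+1; c.+1; d.+1] \in L) == crossing ltn a b c d.
exact: (perm4_ind B).
Qed.

Lemma mem_Pi_S (p : 'S_4) :
  (p \in Pi_S) = rooted (fun i j : 'I_4 => p i < p j) i0 i1 i2 i3.
Proof.
rewrite inE one_line4; set L := (X in _ \in X); apply/eqP.
pose B a b c d := ([:: a.+1; b.+1; c.+1; d.+1] \in L) == rooted ltn a b c d.
exact: (perm4_ind B).
Qed.

Lemma four_positions n (x0 x1 x2 x3 : 'I_n) : x0 < x1 -> x1 < x2 -> x2 < x3 ->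
  {f : 'I_4 -> 'I_n | {homo f : i j / i < j}
     & [/\ f i0 = x0, f i1 = x1, f i2 = x2 & f i3 = x3]}.
Proof.
move=> x01 x12 x23; exists (tnth [tuple x0; x1; x2; x3]) => //.
have x02 := ltn_trans x01 x12; have x13 := ltn_trans x12 x23.
have x03 := ltn_trans x01 x13.
by move=> [[|[|[|[|//]]]] ?] [[|[|[|[|//]]]] ?].
Qed.

Lemma avoiders_Pi_AP m (s : 'S_m.+1) :
  s \in avoiders m.+1 Pi_A <->
  forall i j k : 'I_m.+1, 0 < i -> i < j -> j < k ->
    ~~ crossing ltn (s ord0) (s i) (s j) (s k).
Proof.
rewrite (avoiders_relP _ _ _ (fun r => crossing r i0 i1 i2 i3) s); first last.
- exact: mem_Pi_A.
- by move=> r r' eq_r; rewrite /crossing /between !eq_r.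
split=> [avoid i j k i_gt0 ij jk | avoid f f_homo].
  have [f f_homo [f0 f1 f2 f3]] := four_positions _ ord0 i j k i_gt0 ij jk.
  by have := avoid f f_homo; rewrite /crossing /between f0 f1 f2 f3.
have lt01 : f i0 < f i1 by apply: f_homo.
have lt12 : f i1 < f i2 by apply: f_homo.
have lt23 : f i2 < f i3 by apply: f_homo.
have := avoid (f i1) (f i2) (f i3) (leq_ltn_trans (leq0n _) lt01) lt12 lt23.
have [f0_eq0 | f0_gt0] := posnP (f i0 : nat).
  by have -> : ord0 = f i0 by apply: val_inj.
have := avoid (f i0) (f i2) (f i3) f0_gt0 (ltn_trans lt01 lt12) lt23.
(* [f i0] and [f i1] are on the same side of the chord as [ord0]. *)
by rewrite /crossing /between; do 3!case: (_ || _).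
Qed.

(** The entry 0 can serve as the 1 of a pattern from any position, so a bad triple of nonzero
    entries extends to a pattern. Conversely, three entries above the least one of a pattern are
    nonzero. *)
Lemma avoiders_Pi_SP m (s : 'S_m.+1) :
  s \in avoiders m.+1 Pi_S <->
  forall i j k : 'I_m.+1, i < j -> j < k -> 0 < s i -> 0 < s j -> 0 < s k ->
    ~~ between ltn (s k) (s i) (s j).
Proof.
rewrite (avoiders_relP _ _ _ (fun r => rooted r i0 i1 i2 i3) s); first last.
- exact: mem_Pi_S.
- by move=> r r' eq_r; rewrite /rooted /between !eq_r.
split=> [avoid i j k ij jk si sj sk | avoid f f_homo].
  pose z := (s^-1)%g ord0.
  have sz : s z = ord0 by rewrite permKV.
  have neq_z x : 0 < s x -> (x : nat) != z.
    by apply: contraTneq => /val_inj->; rewrite sz.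
  apply/negP => btw.
  have := neq_z _ si; have := neq_z _ sj; have := neq_z _ sk.
  have avoid4 (x0 x1 x2 x3 : 'I_m.+1)
      (x01 : x0 < x1) (x12 : x1 < x2) (x23 : x2 < x3) :
      ~~ rooted ltn (s x0) (s x1) (s x2) (s x3).
    have [f f_homo [f0 f1 f2 f3]] := four_positions _ x0 x1 x2 x3 x01 x12 x23.
    by have := avoid f f_homo; rewrite /rooted /between f0 f1 f2 f3.
  (* The four places of the 0 relative to the triple match the four disjuncts of [rooted]. *)
  case: (ltngtP i z) => // [iz | zi] neq_zk neq_zj _; last first.
    by have := avoid4 z i j k zi ij jk; rewrite /rooted sz /= si sj sk btw.
  case: (ltngtP j z) neq_zj => // [jz | zj] _; last first.
    have := avoid4 i z j k iz zj jk.
    by rewrite /rooted sz /= si sj sk btw ?orbT.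
  case: (ltngtP k z) neq_zk => // [kz | zk] _; last first.
    have := avoid4 i j z k ij jz zk.
    by rewrite /rooted sz /= si sj sk btw ?orbT.
  have := avoid4 i j k z ij jk kz.
  by rewrite /rooted sz /= si sj sk btw ?orbT.
have lt01 : f i0 < f i1 by apply: f_homo.
have lt12 : f i1 < f i2 by apply: f_homo.
have lt23 : f i2 < f i3 by apply: f_homo.
have lt02 := ltn_trans lt01 lt12; have lt13 := ltn_trans lt12 lt23.
have pos x y : s x < s y -> 0 < s y by apply: leq_ltn_trans.
apply/negP => /or4P[] /and4P[/pos p1 /pos p2 /pos p3]; apply/negP.
- exact: avoid lt12 lt23 p1 p2 p3.
- exact: avoid lt02 lt23 p1 p2 p3.
- exact: avoid lt01 lt13 p1 p2 p3.
- exact: avoid lt01 lt12 p1 p2 p3.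
Qed.

(** * Rotation of values, reversal of positions, and the bijection *)

(* [y - a] modulo [m.+1]. *)
Definition turn {m} (a y : 'I_m.+1) : 'I_m.+1 :=
  inord (if a <= y then y - a else y + m.+1 - a).

(* The entry 0 of [psi s] stands at [a = s ord0]; the other entries of [psi s],
   from left to right, come from the positions m, ..., 1 of [s]. *)
Definition flip {m} (a p : 'I_m.+1) : 'I_m.+1 :=
  inord (if p == a then 0 else if p < a then m - p else m.+1 - p).

Lemma turnE m (a y : 'I_m.+1) :
  turn a y = (if a <= y then y - a else y + m.+1 - a) :> nat.
Proof.
rewrite inordK //; have := ltn_ord a; have := ltn_ord y.
by case: (leqP a y); lia.
Qed.

(** Skipping the slot [a] costs one, whence [m.+1] instead of [m] beyond it. *)
Lemma flipE m (a p : 'I_m.+1) :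
  flip a p =
    (if p == a :> nat then 0 else if p < a then m - p else m.+1 - p) :> nat.
Proof.
rewrite inordK //; have := ltn_ord a; have := ltn_ord p.
by rewrite -val_eqE /=; case: (ltngtP p a); lia.
Qed.

Lemma turn_inj m (a : 'I_m.+1) : injective (turn a).
Proof.
move=> x y /(congr1 val); rewrite /= !turnE => eq_xy; apply: val_inj => /=.
move: eq_xy (ltn_ord a) (ltn_ord x) (ltn_ord y).
by case: (leqP a x); case: (leqP a y); lia.
Qed.

Lemma flip_inj m (a : 'I_m.+1) : injective (flip a).
Proof.
move=> x y /(congr1 val); rewrite /= !flipE => eq_xy; apply: val_inj => /=.
move: eq_xy (ltn_ord a) (ltn_ord x) (ltn_ord y).
by case: (ltngtP x a); case: (ltngtP y a); lia.
Qed.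

(** Rotation preserves separation by a chord, and once [a] sits at 0 it lies between no two
    values. *)
Lemma crossing_turn m (a b c d : 'I_m.+1) : uniq [:: a; b; c; d] ->
  crossing ltn a b c d = between ltn (turn a b) (turn a c) (turn a d).
Proof.
rewrite /= !inE !negb_or -!val_eqE /= /crossing /between /= !turnE.
have := ltn_ord a; have := ltn_ord b; have := ltn_ord c; have := ltn_ord d.
by case: (leqP a b); case: (leqP a c); case: (leqP a d); lia.
Qed.

Lemma flip_lt m (a p q : 'I_m.+1) : p != a -> q != a ->
  (flip a p < flip a q) = (q < p).
Proof.
rewrite -!val_eqE /= !flipE.
have := ltn_ord p; have := ltn_ord q.
by case: (ltngtP p a); case: (ltngtP q a); lia.
Qed.

(** Products apply the left factor first: [flip] acts on positions, [turn] on values. *)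
Definition psi {m} (s : 'S_m.+1) : 'S_m.+1 :=
  (perm (flip_inj _ (s ord0)) * s * perm (turn_inj _ (s ord0)))%g.

Lemma psiE m (s : 'S_m.+1) p :
  psi s p = turn (s ord0) (s (flip (s ord0) p)).
Proof. by rewrite !permM !permE. Qed.

Lemma turnxx m (a : 'I_m.+1) : turn a a = ord0.
Proof. by apply: val_inj; rewrite /= turnE leqnn subnn. Qed.

Lemma flipxx m (a : 'I_m.+1) : flip a a = ord0.
Proof. by apply: val_inj; rewrite /= flipE eqxx. Qed.

Lemma psi_head m (s : 'S_m.+1) : psi s (s ord0) = ord0.
Proof. by rewrite psiE flipxx turnxx. Qed.

(** The position of 0 in [psi s] reveals [s ord0], hence both outer factors, which then cancel. *)
Lemma psi_inj m : injective (@psi m).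
Proof.
move=> s t eq_st.
have eq0 : s ord0 = t ord0.
  by apply: (@perm_inj _ (psi t)); rewrite -{1}eq_st !psi_head.
by move: eq_st; rewrite /psi eq0 => /mulIg/mulgI.
Qed.

Lemma psi_avoiders m (s : 'S_m.+1) :
  (psi s \in avoiders m.+1 Pi_S) = (s \in avoiders m.+1 Pi_A).
Proof.
pose a := s ord0.
have psi_gt0 p : (0 < psi s p) = (p != a).
  rewrite lt0n -(inj_eq (@perm_inj _ (psi s)) p) psi_head.
  by rewrite -val_eqE.
have step (p q r : 'I_m.+1) : p < q -> q < r -> p != a -> q != a -> r != a ->
    between ltn (psi s r) (psi s p) (psi s q) =
    crossing ltn a (s (flip a r)) (s (flip a q)) (s (flip a p)).
  move=> pq qr pa qa ra; rewrite crossing_turn; last first.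
    (* Since [a] is [s (flip a a)], all four values are images under one injection. *)
    have := map_inj_uniq (inj_comp (@perm_inj _ s) (flip_inj _ a))
      [:: a; r; q; p].
    rewrite [map _ _]/= flipxx -/a => ->.
    rewrite /= !inE !negb_or !(eq_sym a) pa qa ra -!val_eqE /=.
    by rewrite !gtn_eqF // (ltn_trans pq).
  by rewrite /between !psiE orbC.
apply/idP/idP.
  move=> /avoiders_Pi_SP avoid; apply/avoiders_Pi_AP => i j k i_gt0 ij jk.
  (* Pull the positions of [s] back along [flip a], which reverses their order. *)
  have [g _ flipK] := injF_bij (flip_inj _ a).
  have ga (x : 'I_m.+1) : 0 < x -> g x != a.
    by apply: contraTneq => eq_ga; rewrite -(flipK x) eq_ga flipxx.
  have gi := ga _ i_gt0.
  have gj := ga _ (ltn_trans i_gt0 ij).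
  have gk := ga _ (ltn_trans (ltn_trans i_gt0 ij) jk).
  have kj : g k < g j by rewrite -(flip_lt _ a) // !flipK.
  have ji : g j < g i by rewrite -(flip_lt _ a) // !flipK.
  have := avoid _ _ _ kj ji; rewrite !psi_gt0 => /(_ gk gj gi).
  by rewrite step // !flipK.
move=> /avoiders_Pi_AP avoid; apply/avoiders_Pi_SP => p q r pq qr.
rewrite !psi_gt0 => pa qa ra; rewrite step //; apply: avoid.
- rewrite lt0n -[0]/(val (@ord0 m)) val_eqE -(flipxx _ a).
  by rewrite (inj_eq (flip_inj _ a)).
- by rewrite flip_lt.
- by rewrite flip_lt.
Qed.

(** The equality of predicates lets the inverse restrict as well. *)
Lemma bijective_sig (T : Type) (A B : pred T) (f : T -> T) :
    bijective f -> (forall x, B (f x) = A x) ->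
  {g : {x | A x} -> {x | B x} | bijective g}.
Proof.
move=> bij_f fAB.
have fA x : A x -> B (f x) by rewrite fAB.
exists (fun x => exist _ (f (sval x)) (fA _ (svalP x))).
case: bij_f => g fK gK.
have gB y : B y -> A (g y) by rewrite -fAB gK.
exists (fun y => exist _ (g (sval y)) (gB _ (svalP y))).
  by move=> x; apply: val_inj; apply: fK.
by move=> y; apply: val_inj; apply: gK.
Qed.

Lemma avoiders0 k (P : {set 'S_k.+1}) (s : 'S_0) : s \in avoiders 0 P.
Proof.
rewrite inE; apply/forall_inP => p _; apply/existsPn => f.
by case: (f ord0).
Qed.

Theorem corollary6p4 (n : nat) :
  {psi : {s : 'S_n | s \in avoiders n Pi_A} ->
         {s : 'S_n | s \in avoiders n Pi_S} | bijective psi}.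
Proof.
(* For size 0 there is no first entry to rotate by, but both sets are all of ['S_0]. *)
case: n => [|m].
  by apply: (bijective_sig _ _ _ id); [exists id | move=> s; rewrite !avoiders0].
exact: bijective_sig _ _ _ psi (injF_bij (psi_inj m)) (@psi_avoiders m).
Qed.
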